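(* Let a torus $T$ act linearly and effectively on a finite-dimensional complex vector space $V=\bigoplus_{i=1}^{\dim V}V_i$, a sum of one-dimensional representations, $T$ acting on $V_i$ with weight $\rho_i$, and let $\xi\in\mathfrak t^\vee_{\mathbb Z}$ be a regular linearization. Let $R\in\mathbb Z^{\dim V}$ and let $\mathbb C^\ast$ act on $V$ by $(s\cdot v)_i=s^{R_i}v_i$, inducing an action on $V/\!/T$. Then the map $$\mathfrak M^\xi\to\{\text{connected components of }(V/\!/T)^{\mathbb C^\ast}\},\qquad P\mapsto\mathcal B_P,$$ is a bijection between the set of stable isolated intersections and the set of connected components of the fixed locus. For a connected component $F$ of $(V/\!/T)^{\mathbb C^\ast}$ let $I_F=\{i\in\{1,\dots,\dim V\}: F\nsubseteq V(v_i)\}$, where $v_i$ is the coordinate on $V_i$. Then the inverse map is given by $F\mapsto\bigcap_{i\in I_F}V(f_i)$.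
   Context: $\mathfrak t$ is the complex Lie algebra of $T$. The linearization associated with $\xi$ (viewed as a character $\chi$ of $T$) is $V\times\mathbb C$ with $t\cdot(v,z)=(t\cdot v,\chi(t)^{-1}z)$; $\xi$ is regular if all semistable points are stable. $V/\!/T$ is the corresponding GIT quotient. Let $f_i:\mathfrak t\to\mathbb C$, $f_i(u)=\rho_i(u)+R_i$, and $V(f_i)=\{f_i=0\}\subset\mathfrak t$. The set of isolated intersections $\mathfrak M\subset\mathfrak t$ consists of points $P$ such that $\bigcap_{i\in I}V(f_i)=\{P\}$ for some $I\subseteq\{1,\dots,\dim V\}$. For $P\in\mathfrak M$: $I_P=\{i:f_i(P)=0\}$, $\mathcal W_P=\{\rho_i:i\in I_P\}$. The stable isolated intersections are $\mathfrak M^\xi=\{P\in\mathfrak M:\xi\in\mathrm{Span}_{\mathbb R_{\ge0}}(\mathcal W_P)\}$. For $P\in\mathfrak M^\xi$, $\mathcal B_P=\bigcap_{j\notin I_P}V(v_j)\subseteq V/\!/T$ is the locus where all coordinates $v_j$ with $j\notin I_P$ vanish, i.e. the GIT quotient by $T$ of $V_P=\bigoplus_{i\in I_P}V_i$. *)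

(* Defs.v *)
From HB Require Import structures.
From mathcomp Require Import all_boot all_order all_algebra.
From mathcomp Require Import all_classical all_reals topology.
From mathcomp Require Import complex.
(* the notations of mpoly clash with those of MathComp-Analysis *)
From mathcomp Require Import -(notations) mpoly.

Set Implicit Arguments.
Unset Strict Implicit.
Unset Printing Implicit Defensive.

Import Order.TTheory GRing.Theory Num.Theory.
Local Open Scope ring_scope.
Local Open Scope complex_scope.
Local Open Scope classical_set_scope.

(* The complex numbers are R[i] for R : realType.  The torus is T = (C\{0})^k,
   with character lattice Z^k ('rV[int]_k) and Lie algebra C^k ('rV[R[i]]_k). *)

(* V = C^n with the Zariski topology, in a fixed basis of weight vectors. *)
Definition affine_space (R : realType) (n : nat) : Type := 'rV[R[i]]_n.

HB.instance Definition _ R n := Choice.copy (affine_space R n) 'rV[R[i]]_n.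

Definition peval (R : realType) (n : nat) (p : mpoly n R[i])
    (v : affine_space R n) : R[i] :=
  meval (fun i => (v : 'rV_n) 0 i) p.

Definition principal_open (R : realType) (n : nat) (p : mpoly n R[i]) :
    set (affine_space R n) :=
  [set v | peval p v != 0].

Section ZariskiTopology.
Variables (R : realType) (n : nat).

(* unions of principal open sets *)
Definition zariski_open (U : set (affine_space R n)) : Prop :=
  forall v, U v -> exists2 p, principal_open p v & principal_open p `<=` U.

Lemma zariski_openT : zariski_open setT.
Proof.
by move=> v _; exists 1 => //; rewrite /principal_open /= /peval rmorph1 oner_neq0.
Qed.

Lemma zariski_openI : setI_closed zariski_open.
Proof.
move=> A B oA oB v [/oA [p pv pA] /oB [q qv qB]].
have E w : principal_open (p * q) w <-> principal_open p w /\ principal_open q w.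
  rewrite /principal_open /= /peval rmorphM mulf_eq0 negb_or.
  by split=> [/andP[]|[-> ->]].
exists (p * q); first exact/E.
by move=> w /E[/pA ? /qB ?].
Qed.

Lemma zariski_open_bigU (I : Type) (f : I -> set (affine_space R n)) :
  (forall i, zariski_open (f i)) -> zariski_open (\bigcup_i f i).
Proof.
by move=> of_ v [i _ /of_ [p pv pf]]; exists p => // w /pf fw; exists i.
Qed.

HB.instance Definition _ := isOpenTopological.Build (affine_space R n)
  zariski_openT zariski_openI zariski_open_bigU.

End ZariskiTopology.

Section TorusAction.
Variables (R : realType) (k n : nat).
(* row i of rho is the weight of T on the i-th coordinate line V_i *)
Variable rho : 'M[int]_(n, k).

Definition torus : set 'rV[R[i]]_k := [set t | forall j, t 0 j != 0].

Definition torus_char (a : 'rV[int]_k) (t : 'rV[R[i]]_k) : R[i] :=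
  \prod_j t 0 j ^ a 0 j.

Definition torus_act (t : 'rV[R[i]]_k) (v : affine_space R n) :
    affine_space R n :=
  \row_i (torus_char (row i rho) t * (v : 'rV_n) 0 i).

Definition effective_action : Prop :=
  forall t, torus t -> (forall v, torus_act t v = v) -> t = const_mx 1.

Definition torus_orbit (v : affine_space R n) : set (affine_space R n) :=
  [set torus_act t v | t in torus].

Definition torus_stabilizer (v : affine_space R n) : set 'rV[R[i]]_k :=
  torus `&` [set t | torus_act t v = v].

Section Linearization.
Variable xi : 'rV[int]_k.

Definition lin_act (t : 'rV[R[i]]_k) (x : affine_space R n * R[i]) :
    affine_space R n * R[i] :=
  (torus_act t x.1, (torus_char xi t)^-1 * x.2).

(* T-invariant functions p(v) z^m on the linearized V x C.  As in King's work,
   V x C is the total space of the dual of the linearizing line bundle L, so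
   these are the T-invariant sections of L^m: p(t.v) = chi(t)^m p(v). *)
Definition invariant_section (m : nat) (p : mpoly n R[i]) : Prop :=
  forall t x, torus t ->
    peval p (lin_act t x).1 * (lin_act t x).2 ^+ m = peval p x.1 * x.2 ^+ m.

Definition semistable (v : affine_space R n) : Prop :=
  exists (m : nat) (p : mpoly n R[i]),
    [/\ (0 < m)%N, invariant_section m p & principal_open p v].

Definition stable (v : affine_space R n) : Prop :=
  finite_set (torus_stabilizer v) /\
  exists (m : nat) (p : mpoly n R[i]),
    [/\ (0 < m)%N, invariant_section m p, principal_open p v &
        forall w, principal_open p w ->
          closure (torus_orbit w) `&` principal_open p `<=` torus_orbit w].

Definition regular_linearization : Prop := forall v, semistable v -> stable v.

(* Points of V//T: semistable points are identified when the closures of their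
   orbits meet in the semistable locus. *)
Definition git_class (v : affine_space R n) : set (affine_space R n) :=
  [set w | semistable w /\
    (closure (torus_orbit v) `&` closure (torus_orbit w) `&` semistable) !=set0].

Record git_quotient : Type := GitPoint {
  git_point : set (affine_space R n) ;
  git_pointP : exists2 v, semistable v & git_point = git_class v }.

Definition git_proj (v : affine_space R n) (hv : semistable v) : git_quotient :=
  GitPoint (ex_intro2 _ _ v hv erefl).

HB.instance Definition _ := gen_eqMixin git_quotient.
HB.instance Definition _ := gen_choiceMixin git_quotient.

(* The quotient topology; the semistable locus is open in V, so open subsets of
   the semistable locus are the same as open subsets of V contained in it. *)
Definition git_open (U : set git_quotient) : Prop :=
  open [set v | exists hv : semistable v, U (git_proj hv)].

Lemma git_openT : git_open setT.
Proof.
move=> v [[m [p [m0 ip pv]]] _]; exists p => // w pw.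
by have hw : semistable w by [exists m, p]; exists hw.
Qed.

Lemma git_openI : setI_closed git_open.
Proof.
move=> A B oA oB; rewrite /git_open.
rewrite (_ : mkset _ = [set v | exists hv : semistable v, A (git_proj hv)] `&`
  [set v | exists hv : semistable v, B (git_proj hv)]); first exact: openI.
apply/seteqP; split=> v /=; first by move=> [hv [Av Bv]]; split; exists hv.
move=> [[hv Av] [hv' Bv]]; exists hv; split => //.
by rewrite (Prop_irrelevance hv hv').
Qed.

Lemma git_open_bigU (I : Type) (f : I -> set git_quotient) :
  (forall i, git_open (f i)) -> git_open (\bigcup_i f i).
Proof.
move=> of_; rewrite /git_open.
rewrite (_ : mkset _ =
  \bigcup_i [set v | exists hv : semistable v, f i (git_proj hv)]).
  by apply: bigcup_open => i _; exact: of_.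
apply/seteqP; split=> v /=; first by move=> [hv [i _ fi]]; exists i => //; exists hv.
by move=> [i _ [hv fi]]; exists hv, i.
Qed.

HB.instance Definition _ := isOpenTopological.Build git_quotient
  git_openT git_openI git_open_bigU.

(* V(v_i) in V//T *)
Definition git_coord_locus (i : 'I_n) : set git_quotient :=
  [set x | exists (v : affine_space R n) (hv : semistable v),
     (v : 'rV_n) 0 i = 0 /\ x = git_proj hv].

End Linearization.

Section Localization.
Variables (xi : 'rV[int]_k) (r : 'rV[int]_n).

Definition cstar_act (s : R[i]) (v : affine_space R n) : affine_space R n :=
  \row_i (s ^ r 0 i * (v : 'rV_n) 0 i).

(* C\{0} commutes with T and preserves semistability, hence permutes the classes
   that are the points of V//T: the induced action sends a class to its image. *)
Definition fixed_locus : set (git_quotient xi) :=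
  [set x | forall s : R[i], s != 0 ->
     [set cstar_act s v | v in git_point x] = git_point x].

Definition fixed_components : set (set (git_quotient xi)) :=
  [set connected_component fixed_locus x | x in fixed_locus].

(* f_i : Lie(T) -> C, where the character rho_i is identified with its
   differential *)
Definition flin (i : 'I_n) (u : 'rV[R[i]]_k) : R[i] :=
  (\sum_j (rho i j)%:~R * u 0 j) + (r 0 i)%:~R.

Definition flin_zero (i : 'I_n) : set 'rV[R[i]]_k := [set u | flin i u = 0].

Definition isolated_intersections : set 'rV[R[i]]_k :=
  [set P | exists I : set 'I_n, \bigcap_(i in I) flin_zero i = [set P]].

Definition index_set (P : 'rV[R[i]]_k) : set 'I_n := [set i | flin i P = 0].

Definition in_weight_cone (I : set 'I_n) (a : 'rV[int]_k) : Prop :=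
  exists c : 'I_n -> R, (forall i, 0 <= c i) /\
    forall j, (a 0 j)%:~R = \sum_(i | i \in I) c i * (rho i j)%:~R.

Definition stable_isolated_intersections : set 'rV[R[i]]_k :=
  isolated_intersections `&` [set P | in_weight_cone (index_set P) xi].

(* B_P *)
Definition git_locus (P : 'rV[R[i]]_k) : set (git_quotient xi) :=
  \bigcap_(j in ~` index_set P) git_coord_locus j.

(* I_F *)
Definition component_index_set (F : set (git_quotient xi)) : set 'I_n :=
  [set i | ~ (F `<=` git_coord_locus i)].

End Localization.
End TorusAction.

Arguments git_coord_locus {R k n} rho xi i.
Arguments fixed_locus {R k n} rho xi r.
Arguments fixed_components {R k n} rho xi r.
Arguments git_locus {R k n} rho xi r P.
Arguments flin {R k n} rho r i u.

(* Main.v *)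
(* By Farkas' lemma and one-parameter subgroups, v is semistable iff xi lies in
   the cone of the weights of its support supp v.  When xi is regular, the points
   of V//T are the T-orbits of semistable v, and the weights in supp v span since
   the stabilizer of v is finite.  The orbit of v is fixed by C^* iff the
   equations f_i(u) = 0, i in supp v, have a solution P, which is then unique and
   is a stable isolated intersection: the fixed locus is the disjoint union of
   the loci B_P.  There are finitely many of them, they are closed, and they are
   irreducible as images of open subsets of the linear spaces V_P, so they are
   the connected components. *)

Require Import Defs.
From mathcomp Require Import all_boot all_order all_algebra.
From mathcomp Require Import all_classical all_reals topology.
From mathcomp Require Import complex.
From mathcomp Require Import ring.
From mathcomp Require Import -(notations) mpoly.

Set Implicit Arguments.
Unset Strict Implicit.
Unset Printing Implicit Defensive.

Import Order.TTheory GRing.Theory Num.Theory.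
Local Open Scope ring_scope.
Local Open Scope complex_scope.
Local Open Scope classical_set_scope.

(** * Farkas' lemma and arithmetic preliminaries *)

(* Bartl's induction on the number of inequalities: if the last one is needed,
   some x violates only it, and one projects along x onto its kernel. *)
Lemma farkas (F : realFieldType) (n k : nat) (A : 'M[F]_(n, k)) (b : 'rV_k) :
  (forall x : 'cV_k, (forall i, (A *m x) i 0 <= 0) -> (b *m x) 0 0 <= 0) ->
  exists2 c : 'rV_n, (forall i, 0 <= c 0 i) & b = c *m A.
Proof.
elim: n A b => [|n IH] A b Ab.
  have b0 (x : 'cV_k) : (b *m x) 0 0 = 0.
    apply/eqP; rewrite eq_le Ab; last by case.
    have: (b *m - x) 0 0 <= 0 by apply: Ab => -[].
    by rewrite mulmxN mxE oppr_le0.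
  exists 0; first by move=> i; rewrite mxE.
  rewrite mul0mx; apply/rowP => j.
  by have := b0 (delta_mx j 0); rewrite -colE !mxE.
pose a : 'rV_k := usubmx (A : 'M_(1 + n, k)).
pose B : 'M_(n, k) := dsubmx (A : 'M_(1 + n, k)).
have AE : A = col_mx a B by rewrite vsubmxK.
have AxP (x : 'cV_k) : (a *m x) 0 0 <= 0 -> (forall i, (B *m x) i 0 <= 0) ->
    (b *m x) 0 0 <= 0.
  move=> ax Bx; apply: Ab => i; rewrite AE (@mul_col_mx _ 1) mxE.
  by case: fintype.split => j //; rewrite ord1.
rewrite AE {AE Ab}.
have [Bb|] := pselect (forall x : 'cV_k, (forall i, (B *m x) i 0 <= 0) ->
                         (b *m x) 0 0 <= 0).
  have [c c0 ->] := IH _ _ Bb.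
  exists (row_mx (0 : 'M_1) c).
    by move=> i; rewrite mxE; case: fintype.split => j //; rewrite mxE.
  by rewrite (@mul_row_col _ _ 1) mul0mx add0r.
move=> /existsNP[y /not_implyP[By /negP]]; rewrite -ltNge => by0.
have ay : 0 < (a *m y) 0 0.
  by rewrite ltNge; apply/negP => ay; move: by0; rewrite ltNge AxP.
pose x := ((a *m y) 0 0)^-1 *: y.
have ax : a *m x = 1%:M.
  apply/matrixP => i j; rewrite !ord1 -scalemxAr mxE [RHS]mxE eqxx.
  by rewrite mulVf // gt_eqF.
have Bx i : (B *m x) i 0 <= 0.
  by rewrite -scalemxAr mxE mulr_ge0_le0 // invr_ge0 ltW.
have bx : 0 <= (b *m x) 0 0.
  by rewrite -scalemxAr mxE mulr_ge0 // ?invr_ge0 ltW.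
pose P := 1%:M - x *m a.
have aP : a *m P = 0 by rewrite mulmxBr mulmx1 mulmxA ax mul1mx subrr.
have BbP (z : 'cV_k) :
    (forall i, (B *m P *m z) i 0 <= 0) -> (b *m P *m z) 0 0 <= 0.
  rewrite -!mulmxA => Bz; rewrite AxP //.
  by rewrite mulmxA aP mul0mx mxE.
have [c c0] := IH _ _ BbP.
rewrite mulmxA !mulmxBr !mulmx1 !mulmxA => bE.
(* Expanding [b P = c B P] with [P = 1 - x a] leaves this coefficient for [a]; it is nonnegative as
   [b x >= 0], [c >= 0] and [B x <= 0]. *)
exists (row_mx (b *m x - c *m B *m x) c).
  move=> i; rewrite mxE; case: fintype.split => j //.
  rewrite ord1 mxE [X in _ + X]mxE subr_ge0 (le_trans _ bx) // -mulmxA mxE.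
  by apply: sumr_le0 => l _; exact: mulr_ge0_le0.
by rewrite (@mul_row_col _ _ 1) mulmxBl addrAC -addrA -bE addrC subrK.
Qed.

(** Turns rational solutions of linear systems into exponents of monomials and of one-parameter
    subgroups. *)
Lemma common_denominator (I : finType) (f : I -> rat) :
  exists2 N : nat, (0 < N)%N &
    exists g : I -> int, forall i, N%:R * f i = (g i)%:~R.
Proof.
exists (\prod_i `|denq (f i)|)%N.
  by rewrite prodn_gt0 // => i; rewrite absz_gt0 denq_neq0.
exists (fun i => (\prod_(j | j != i) `|denq (f j)|)%N%:Z * numq (f i)) => i.
rewrite (bigD1 i) //= natrM intrM mulrAC mulrC; congr (_ * _).
rewrite natr_absz (ger0_norm (denq_ge0 _)) -[X in _ * X](divq_num_den (f i)).
by rewrite mulrC divfK // intr_eq0 denq_neq0.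
Qed.

(** In characteristic zero the positive integers are infinitely many candidates. Zero is left out so
    that the point found can serve as a parameter in the multiplicative group. *)
Lemma poly_nonroot (F : numFieldType) (p : {poly F}) :
  p != 0 -> exists m : nat, p.[m.+1%:R] != 0.
Proof.
move=> p0; apply: contrapT => /forallNP rp.
pose rs : seq F := [seq m.+1%:R | m <- iota 0 (size p)].
suff: (size rs < size p)%N by rewrite size_map size_iota ltnn.
apply: max_poly_roots => //.
  by apply/allP => _ /mapP[m _ ->]; move: (rp m) => /negP; rewrite negbK.
by rewrite map_inj_uniq ?iota_uniq // => a b /eqP; rewrite eqr_nat eqSS => /eqP.
Qed.

Lemma exprz_sum (F : fieldType) (I : Type) (s : seq I) (x : F) (f : I -> int) :
  x != 0 -> x ^ (\sum_(i <- s) f i) = \prod_(i <- s) x ^ f i.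
Proof. by move=> x0; apply: big_morph => // a b; rewrite expfzDr. Qed.

Lemma exprz_prod (F : fieldType) (I : Type) (s : seq I) (f : I -> F) (m : int) :
  (\prod_(i <- s) f i) ^ m = \prod_(i <- s) f i ^ m.
Proof.
elim: s => [|i s IH]; first by rewrite !big_nil exp1rz.
by rewrite !big_cons expfzMl IH.
Qed.

(** * Characters and one-parameter subgroups *)

Section Torus.
Variables (R : realType) (k : nat).
Implicit Types (a b : 'rV[int]_k) (t : 'rV[R[i]]_k).

Definition torus_mul t t' : 'rV[R[i]]_k := \row_j (t 0 j * t' 0 j).
Definition torus_inv t : 'rV[R[i]]_k := \row_j (t 0 j)^-1.
Definition one_psg (l : 'I_k -> int) (s : R[i]) : 'rV[R[i]]_k := \row_j s ^ l j.

Lemma torus_charM a t t' :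
  torus_char a (torus_mul t t') = torus_char a t * torus_char a t'.
Proof.
by rewrite /torus_char -big_split; apply: eq_bigr => j _; rewrite mxE expfzMl.
Qed.

Lemma torus_charV a t : torus_char a (torus_inv t) = (torus_char a t)^-1.
Proof.
rewrite /torus_char -prodfV; apply: eq_bigr => j _.
by rewrite mxE exprz_inv -invr_expz.
Qed.

Lemma torus_char_neq0 a t : torus t -> torus_char a t != 0.
Proof.
by move=> tt; rewrite prodf_seq_neq0; apply/allP => j _; exact/expfz_neq0.
Qed.

Lemma torus_one : torus (const_mx 1 : 'rV[R[i]]_k).
Proof. by move=> j; rewrite mxE oner_neq0. Qed.

Lemma torus_char_one a : torus_char a (const_mx 1 : 'rV[R[i]]_k) = 1.
Proof. by rewrite /torus_char big1 // => j _; rewrite mxE exp1rz. Qed.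

Lemma torus_torus_mul t t' : torus t -> torus t' -> torus (torus_mul t t').
Proof. by move=> tt tt' j; rewrite mxE mulf_neq0. Qed.

Lemma torus_torus_inv t : torus t -> torus (torus_inv t).
Proof. by move=> tt j; rewrite mxE invr_eq0. Qed.

Lemma torus_one_psg (l : 'I_k -> int) (s : R[i]) :
  s != 0 -> torus (one_psg l s).
Proof. by move=> s0 j; rewrite mxE expfz_neq0. Qed.

Lemma torus_char_one_psg a (l : 'I_k -> int) (s : R[i]) :
  s != 0 -> torus_char a (one_psg l s) = s ^ (\sum_j a 0 j * l j).
Proof.
move=> s0; rewrite exprz_sum //; apply: eq_bigr => j _.
by rewrite mxE exprz_exp mulrC.
Qed.

Lemma torus_char_sum (I : finType) (a : I -> 'rV[int]_k) (m : I -> int) b t :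
  torus t -> (forall j, b 0 j = \sum_i m i * a i 0 j) ->
  torus_char b t = \prod_i torus_char (a i) t ^ m i.
Proof.
move=> tt bE.
under [RHS]eq_bigr do rewrite /torus_char exprz_prod.
rewrite exchange_big; apply: eq_bigr => j _.
rewrite bE exprz_sum //; apply: eq_bigr => i _.
by rewrite exprz_exp mulrC.
Qed.

End Torus.

(** * Polynomial functions along curves, and monomials *)

Lemma peval_poly_curve (R : realType) (n : nat) (p : mpoly n R[i])
    (q : 'I_n -> {poly R[i]}) :
  exists Q : {poly R[i]}, forall s, peval p (\row_i (q i).[s]) = Q.[s].
Proof.
exists (\sum_(m <- msupp p) (mcoeff m p)%:P * \prod_i q i ^+ m i) => s.
rewrite /peval mevalE horner_sum; apply: eq_bigr => m _.
rewrite hornerM hornerC horner_prod; congr (_ * _).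
by apply: eq_bigr => i _; rewrite mxE horner_exp.
Qed.

Lemma pevalM (R : realType) (n : nat) (p q : mpoly n R[i]) v :
  peval (p * q) v = peval p v * peval q v.
Proof. by rewrite /peval rmorphM. Qed.

Definition mcoord (R : realType) (n : nat) (i : 'I_n) : mpoly n R[i] :=
  mpolyX _ (mnm1 i).

Lemma peval_coord (R : realType) (n : nat) (i : 'I_n) (v : affine_space R n) :
  peval (mcoord R i) v = (v : 'rV_n) 0 i.
Proof. exact: mevalXU. Qed.

Lemma peval_monomial (R : realType) (n : nat) (m : 'I_n -> nat)
    (v : affine_space R n) :
  peval (\prod_i mcoord R i ^+ m i) v = \prod_i (v : 'rV_n) 0 i ^+ m i.
Proof.
rewrite /peval rmorph_prod; apply: eq_bigr => i _.
by rewrite rmorphXn /= mevalXU.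
Qed.

(** * The cone criterion for semistability *)

Section Semistability.
Variables (R : realType) (k n : nat) (rho : 'M[int]_(n, k)) (xi : 'rV[int]_k).
Implicit Types (v w : affine_space R n) (I : set 'I_n) (t : 'rV[R[i]]_k).

Definition supp v : set 'I_n := [set i | (v : 'rV_n) 0 i != 0].

Lemma torus_act1 v : torus_act rho (const_mx 1) v = v.
Proof. by apply/rowP => i; rewrite mxE torus_char_one mul1r. Qed.

Lemma torus_act_comp t t' v :
  torus_act rho t (torus_act rho t' v) = torus_act rho (torus_mul t t') v.
Proof. by apply/rowP => i; rewrite !mxE torus_charM mulrA. Qed.

Lemma torus_actK t v :
  torus t -> torus_act rho (torus_inv t) (torus_act rho t v) = v.
Proof.
by move=> tt; apply/rowP => i; rewrite !mxE torus_charV mulKf ?torus_char_neq0.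
Qed.

Lemma torus_orbit_refl v : torus_orbit rho v v.
Proof. by exists (const_mx 1); [exact: torus_one | exact: torus_act1]. Qed.

Lemma torus_orbit_eq v w :
  torus_orbit rho v w -> torus_orbit rho w = torus_orbit rho v.
Proof.
move=> [t tt <-]; apply/seteqP; split=> _ [t' tt' <-].
  by exists (torus_mul t' t); [exact: torus_torus_mul | rewrite torus_act_comp].
exists (torus_mul t' (torus_inv t)).
  by apply: torus_torus_mul => //; exact: torus_torus_inv.
by rewrite -torus_act_comp torus_actK.
Qed.

Lemma torus_orbit_coord v w i : torus_orbit rho v w ->
  ((w : 'rV_n) 0 i == 0) = ((v : 'rV_n) 0 i == 0).
Proof.
by move=> [t tt <-]; rewrite mxE mulf_eq0 (negbTE (torus_char_neq0 _ tt)).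
Qed.

Lemma peval_torus_act m p t v : invariant_section rho xi m p -> torus t ->
  peval p (torus_act rho t v) = torus_char xi t ^+ m * peval p v.
Proof.
(* Fibre coordinate 1 reduces invariance to [p(t.v) = chi(t)^m p(v)]. *)
move=> /(_ t (v, 1)) pinv tt; move: (pinv tt) => /=.
rewrite expr1n !mulr1 exprVn => <-.
by rewrite mulrCA mulfV ?mulr1 // expf_neq0 // torus_char_neq0.
Qed.

Lemma principal_open_orbit m p v w : invariant_section rho xi m p ->
  torus_orbit rho v w -> principal_open p w <-> principal_open p v.
Proof.
move=> pinv [t tt <-].
rewrite /principal_open /= (peval_torus_act _ pinv tt) mulf_eq0.
by rewrite (negbTE (expf_neq0 _ (torus_char_neq0 _ tt))).
Qed.

Lemma semistable_orbit v w :
  semistable rho xi v -> torus_orbit rho v w -> semistable rho xi w.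
Proof.
move=> [m [p [m0 pinv pv]]] vw; exists m, p; split=> //.
exact/(principal_open_orbit pinv vw).
Qed.

(** For [I = supp v]: the limit of [l(s).v] as [s] tends to 0 exists. *)
Definition weights_nonneg I (l : 'I_k -> int) :=
  forall i, i \in I -> 0 <= \sum_j rho i j * l j.

Lemma in_weight_cone_nonneg I (l : 'I_k -> int) :
  in_weight_cone R rho I xi -> weights_nonneg I l ->
  0 <= \sum_j xi 0 j * l j.
Proof.
move=> [c [c0 xiE]] Il; rewrite -(ler_int R) rmorph_sum /=.
under eq_bigr => j _ do rewrite intrM xiE mulr_suml.
rewrite exchange_big; apply: sumr_ge0 => i iI.
under eq_bigr do rewrite -mulrA -intrM.
by rewrite -mulr_sumr -rmorph_sum mulr_ge0 //= ler0z; apply: Il.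
Qed.

(** Farkas is applied over the rationals, not the reals, so that denominators of the coefficients
    can be cleared. *)
Lemma nonneg_integral_cone I :
  (forall l, weights_nonneg I l -> 0 <= \sum_j xi 0 j * l j) ->
  exists2 N : nat, (0 < N)%N & exists2 m : 'I_n -> nat,
    (forall i, i \notin I -> m i = 0%N) &
    forall j, N%:Z * xi 0 j = \sum_i (m i)%:Z * rho i j.
Proof.
move=> Ixi.
(* Zero rows outside [I] impose no inequality. *)
pose A : 'M[rat]_(n, k) := \matrix_(i, j) if i \in I then (rho i j)%:~R else 0.
pose b : 'rV[rat]_k := \row_j (xi 0 j)%:~R.
have Ab (x : 'cV_k) : (forall i, (A *m x) i 0 <= 0) -> (b *m x) 0 0 <= 0.
  move=> Ax; have [N N0 [l lE]] := common_denominator (fun j => - x j 0).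
  have N0' : 0 < N%:R :> rat by rewrite ltr0n.
  have -> : (b *m x) 0 0 = - (\sum_j xi 0 j * l j)%:~R / N%:R.
    rewrite mxE rmorph_sum /= mulNr mulr_suml -sumrN; apply: eq_bigr => j _.
    by rewrite mxE intrM -lE mulrAC -mulrA -mulrN mulKf ?opprK // gt_eqF.
  rewrite mulNr oppr_le0 divr_ge0 ?(ltW N0') // ler0z; apply: Ixi => i iI.
  rewrite -(ler_int rat) rmorph_sum /=.
  have -> : \sum_j (rho i j * l j)%:~R = N%:R * - (A *m x) i 0.
    rewrite mxE -sumrN mulr_sumr; apply: eq_bigr => j _.
    by rewrite mxE iI intrM -lE -mulrN mulrCA.
  by rewrite mulr_ge0 ?(ltW N0') // oppr_ge0.
have [c c0 bE] := farkas Ab.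
have [N N0 [g gE]] := common_denominator (fun i => c 0 i).
have g0 i : 0 <= g i by rewrite -(ler_int rat) -gE mulr_ge0.
(* Farkas leaves the coefficients of the zero rows arbitrary, so they are reset to 0. *)
exists N => //; exists (fun i => if i \in I then `|g i|%N else 0%N).
  by move=> i /negbTE->.
move=> j; apply: (@intr_inj rat).
have /rowP/(_ j) := bE; rewrite !mxE intrM => ->.
rewrite rmorph_sum /= mulr_sumr; apply: eq_bigr => i _.
rewrite mxE mulrA gE intrM; case: ifP => _; last by rewrite mulr0 mul0r.
by rewrite gez0_abs.
Qed.

Lemma integral_cone_in_weight_cone I (N : nat) (m : 'I_n -> nat) :
  (0 < N)%N -> (forall i, i \notin I -> m i = 0%N) ->
  (forall j, N%:Z * xi 0 j = \sum_i (m i)%:Z * rho i j) ->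
  in_weight_cone R rho I xi.
Proof.
move=> N0 mI NE; exists (fun i => (m i)%:R / N%:R); split.
  by move=> i; rewrite divr_ge0.
have N0' : N%:R != 0 :> R by rewrite pnatr_eq0 -lt0n.
move=> j; apply: (mulfI N0').
transitivity ((N%:Z * xi 0 j)%:~R : R); first by rewrite intrM.
rewrite NE rmorph_sum /= mulr_sumr [RHS]big_mkcond; apply: eq_bigr => i _.
case: ifPn => [_|/mI->]; last by rewrite mul0r.
by rewrite intrM mulrA mulrCA mulfV // mulr1.
Qed.

(* If l pairs nonnegatively with the weights of v, then p(l(s).v) is a
   polynomial in s, while invariance makes it a negative power of s times p(v)
   as soon as l pairs negatively with xi. *)
Lemma semistable_nonneg v (l : 'I_k -> int) :
  semistable rho xi v -> weights_nonneg (supp v) l ->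
  0 <= \sum_j xi 0 j * l j.
Proof.
move=> [m [p [m0 pinv pv]]] vl; rewrite leNgt; apply/negP => xil.
pose e i := \sum_j rho i j * l j.
pose M := \sum_j xi 0 j * l j.
have [Q QE] := peval_poly_curve p (fun i => ((v : 'rV_n) 0 i)%:P * 'X^`|e i|).
have D0 : Q * 'X^(`|M| * m) - (peval p v)%:P = 0.
  apply/eqP; apply: contrapT => /negP/poly_nonroot[a].
  rewrite !(hornerE, hornerXn) -QE; set s : R[i] := a.+1%:R.
  have s0 : s != 0 by rewrite pnatr_eq0.
  rewrite (_ : \row_i _ = torus_act rho (one_psg l s) v); last first.
    apply/rowP => i; rewrite !mxE hornerM hornerC hornerXn torus_char_one_psg //.
    (* Off the support [e i] may be negative and [|e i|] the wrong exponent, but there the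
       coordinate is 0. *)
    have [->|vi0] := eqVneq ((v : 'rV_n) 0 i) 0; first by rewrite mul0r mulr0.
    have ei0 : 0 <= e i by apply: vl; rewrite inE.
    rewrite mulrC; congr (_ * _); rewrite exprnP; congr (s ^ _).
    rewrite abszE ger0_norm //; by apply: eq_bigr => j _; rewrite mxE.
  rewrite (peval_torus_act _ pinv (torus_one_psg l s0)) torus_char_one_psg //.
  rewrite mulrAC exprM -exprMn -/M (_ : s ^ M * s ^+ `|M| = 1).
    by rewrite expr1n mul1r subrr eqxx.
  rewrite exprnP -expfzDr // abszE ltr0_norm //.
  by rewrite subrr expr0z.
(* At 0 the power of [X] vanishes, its exponent being positive, which leaves [p(v) = 0]. *)
have := congr1 (fun q => q.[0]) D0.
rewrite !(hornerE, hornerXn) expr0n muln_eq0 absz_eq0 (lt_eqF xil) /=.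
rewrite (gtn_eqF m0) mulr0 sub0r => /eqP; rewrite oppr_eq0; exact/negP.
Qed.

(** The monomial with exponents [m] has weight [N xi], so it is an invariant section; it involves
    only coordinates that are nonzero at [v]. *)
Lemma integral_cone_semistable v (N : nat) (m : 'I_n -> nat) :
  (0 < N)%N -> (forall i, i \notin supp v -> m i = 0%N) ->
  (forall j, N%:Z * xi 0 j = \sum_i (m i)%:Z * rho i j) ->
  semistable rho xi v.
Proof.
move=> N0 mI NE; exists N, (\prod_i mcoord R i ^+ m i); split=> //.
  move=> t [w z] tt /=; rewrite !peval_monomial.
  under eq_bigr do rewrite mxE exprMn.
  rewrite big_split /= -mulrA mulrCA; congr (_ * _).
  rewrite exprMn mulrA exprVn (_ : \prod_i _ = torus_char xi t ^+ N).
    by rewrite mulfV ?mul1r // expf_neq0 // torus_char_neq0.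
  rewrite exprnP /torus_char exprz_prod.
  transitivity (torus_char (\row_j (N%:Z * xi 0 j)) t).
    rewrite (torus_char_sum (a := fun i => row i rho)
      (m := fun i => (m i)%:Z)) //.
    by move=> j; rewrite mxE NE; apply: eq_bigr => i _; rewrite mxE.
  by apply: eq_bigr => j _; rewrite mxE exprz_exp mulrC.
rewrite /principal_open /= peval_monomial prodf_seq_neq0; apply/allP => i _ /=.
have [vi0|vi0] := eqVneq ((v : 'rV_n) 0 i) 0; last exact: expf_neq0.
by rewrite mI ?expr0 ?oner_neq0 // notin_setE /supp /= vi0 eqxx.
Qed.

(** Both directions pass through the inequalities for one-parameter subgroups and an integral
    relation: it yields real cone coefficients one way and an invariant monomial the other. *)
Lemma semistableP v : semistable rho xi v <-> in_weight_cone R rho (supp v) xi.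
Proof.
split=> [vss|vxi].
  have [N N0 [m mv NE]] :=
    nonneg_integral_cone (fun l => semistable_nonneg (l := l) vss).
  exact: integral_cone_in_weight_cone N0 mv NE.
have [|N N0 [m mv NE]] := @nonneg_integral_cone (supp v).
  by move=> l; exact: in_weight_cone_nonneg.
exact: integral_cone_semistable N0 mv NE.
Qed.

Lemma in_weight_coneS I I' : I `<=` I' ->
  in_weight_cone R rho I xi -> in_weight_cone R rho I' xi.
Proof.
move=> II' [c [c0 xiE]]; exists (fun i => if i \in I then c i else 0).
split=> [i|j]; first by case: ifP.
rewrite xiE big_mkcond [RHS]big_mkcond; apply: eq_bigr => i _.
case: (boolP (i \in I)) => [|_]; last by rewrite mul0r if_same.
by rewrite inE => /II' iI'; rewrite mem_set.
Qed.

End Semistability.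

(** * The linear system of the [f_i] and orbits preserved by the multiplicative group *)

(** As 2 is not a root of unity, integer exponents can be read off at the single parameter 2. *)
Lemma exprz2_inj (F : numFieldType) : injective (exprz (2%:R : F)).
Proof.
move=> a b; rewrite -(ratr_nat F 2) -!fmorphXz => /fmorph_inj.
by apply: ieexprIz.
Qed.

Section WeightSystem.
Variables (R : realType) (k n : nat) (rho : 'M[int]_(n, k)).
Implicit Types (v : affine_space R n) (I : set 'I_n).

(** Columns outside [I] are zeroed rather than deleted, so the size does not depend on [I]; rational
    entries give kernel vectors that can be made integral. *)
Definition weight_mx I : 'M[rat]_(k, n) :=
  \matrix_(j, i) if i \in I then (rho i j)%:~R else 0.

Lemma weight_mxE I (u : 'rV[R[i]]_k) i :
  (u *m map_mx ratr (weight_mx I)) 0 i =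
  if i \in I then \sum_j (rho i j)%:~R * u 0 j else 0.
Proof.
rewrite mxE; case: ifPn => iI; last first.
  by rewrite big1 // => j _; rewrite !mxE (negbTE iI) rmorph0 mulr0.
by apply: eq_bigr => j _; rewrite !mxE iI ratr_int mulrC.
Qed.

(* An integral kernel vector gives a one-parameter subgroup fixing v. *)
Lemma finite_stabilizer_row_free v :
  finite_set (torus_stabilizer rho v) -> row_free (weight_mx (supp v)).
Proof.
move=> vfin; rewrite -kermx_eq0; apply: contrapT => /negP/matrix0Pn[a [b wab]].
set w := row a (kermx (weight_mx (supp v))).
have wA : w *m weight_mx (supp v) = 0 by rewrite -row_mul mulmx_ker row0.
have [N N0 [l lE]] := common_denominator (fun j => w 0 j).
have N0' : N%:R != 0 :> rat by rewrite pnatr_eq0 -lt0n.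
have lb : l b != 0.
  by rewrite -(intr_eq0 rat) -lE mulf_neq0 //; move: wab; rewrite [w _ _]mxE.
have lv i : i \in supp v -> \sum_j rho i j * l j = 0.
  move=> iv; apply: (@intr_inj rat); rewrite rmorph_sum /=.
  have /rowP/(_ i) := wA; rewrite mxE [RHS]mxE => /(congr1 ( *%R N%:R)).
  rewrite mulr0 mulr_sumr => wi; rewrite -[RHS]wi; apply: eq_bigr => j _.
  by rewrite [weight_mx _ _ _]mxE iv mulrA lE intrM mulrC.
(* The powers of 2 give infinitely many points of the subgroup, told apart by coordinate [b], where
   [l b] is nonzero. *)
pose f (m : nat) : 'rV[R[i]]_k := one_psg l (2%:R ^+ m).
have two0 m : 2%:R ^+ m != 0 :> R[i] by rewrite expf_neq0 // pnatr_eq0.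
have f_inj : injective f.
  move=> m m' /rowP/(_ b); rewrite !mxE !exprnP !exprz_exp.
  by move=> /exprz2_inj/(mulIf lb)[].
apply: infinite_nat.
rewrite (_ : setT = f @^-1` torus_stabilizer rho v).
  by apply: finite_preimage => // ? ? _ _; exact: f_inj.
apply/seteqP; split=> // m _; split; first exact: torus_one_psg.
apply/rowP => i; rewrite mxE torus_char_one_psg //.
have [->|vi0] := eqVneq ((v : 'rV_n) 0 i) 0; first by rewrite mulr0.
under eq_bigr do rewrite mxE.
by rewrite lv ?inE // expr0z mul1r.
Qed.

Variable r : 'rV[int]_n.

Definition offset_row I : 'rV[rat]_n :=
  \row_i if i \in I then - (r 0 i)%:~R else 0.

Lemma flin_system I (P : 'rV[R[i]]_k) : I `<=` index_set rho r P <->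
  P *m map_mx ratr (weight_mx I) = map_mx ratr (offset_row I).
Proof.
split=> [IP|/rowP IP i Ii].
  apply/rowP => i; rewrite weight_mxE !mxE; case: ifPn; last by rewrite rmorph0.
  rewrite inE => /IP; rewrite /index_set /flin /= => /eqP.
  by rewrite addr_eq0 => /eqP ->; rewrite rmorphN /= ratr_int.
move: (IP i); rewrite weight_mxE !mxE mem_set // rmorphN /= ratr_int => PI.
by rewrite /index_set /flin /= PI addNr.
Qed.

(** The system is rational, and solvability is insensitive to field extension: a complex solution
    forces a rational one. *)
Lemma flin_solvable I :
  (exists P : 'rV[R[i]]_k, I `<=` index_set rho r P) <->
  (offset_row I <= weight_mx I)%MS.
Proof.
split=> [[P /flin_system PE]|/submxP[D DE]].
  by rewrite -(map_submx (@ratr R[i])); apply/submxP; exists P.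
by exists (map_mx ratr D); apply/flin_system; rewrite DE map_mxM.
Qed.

(* Fredholm alternative: an integral relation among the weights of v yields,
   from t.v = s.v at s = 2, the same relation among the exponents r. *)
Lemma cstar_orbit_solvable v : torus_orbit rho v (cstar_act r 2%:R v) ->
  (offset_row (supp v) <= weight_mx (supp v))%MS.
Proof.
move=> [t tt tv]; rewrite submxE; apply/eqP/rowP => a; rewrite [RHS]mxE.
(* Column [a] of the cokernel is a relation among the weights in the support; its entries elsewhere
   are unconstrained, hence reset to 0. *)
have [N N0 [g gE]] := common_denominator
  (fun i => if i \in supp v then cokermx (weight_mx (supp v)) i a else 0).
have N0' : N%:R != 0 :> rat by rewrite pnatr_eq0 -lt0n.
have tvi i : i \in supp v -> torus_char (row i rho) t = 2%:R ^ r 0 i.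
  rewrite inE /supp /= => vi0; move/rowP/(_ i): tv; rewrite !mxE.
  exact: mulIf.
have gv i : i \notin supp v -> g i = 0.
  by move=> iv; apply: (@intr_inj rat); rewrite -gE (negbTE iv) mulr0.
have grho j : \sum_i g i * row i rho 0 j = 0.
  apply: (@intr_inj rat); rewrite rmorph_sum /=.
  have /matrixP/(_ j a) := mulmx_coker (weight_mx (supp v)).
  rewrite mxE [RHS]mxE => /(congr1 ( *%R N%:R)).
  rewrite mulr0 mulr_sumr => Ng; rewrite -[RHS]Ng; apply: eq_bigr => i _.
  rewrite intrM -gE [weight_mx _ _ _]mxE [row _ _ _ _]mxE; case: ifP => _.
    by rewrite mulrAC mulrA.
  by rewrite mulr0 !mul0r mulr0.
have := @torus_char_sum R k _ (fun i => row i rho) g 0 t tt.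
rewrite /torus_char big1; last by move=> j _; rewrite mxE expr0z.
move=> /(_ _)/esym E; move: E; rewrite -/(torus_char _ _) => E.
(* By the relation, the product of the [rho_i(t)^(g i)] is 1; since [rho_i(t) = 2^(r_i)] on the
   support, it is also 2 to this sum. *)
have gr : \sum_i r 0 i * g i = 0.
  apply: (@exprz2_inj R[i]).
  rewrite expr0z -[RHS]E => [|j]; last by rewrite mxE grho.
  rewrite exprz_sum ?pnatr_eq0 //; apply: eq_bigr => i _.
  case: (boolP (i \in supp v)) => [/tvi tvi'|/gv ->]; last by rewrite mulr0.
  by rewrite -exprz_exp -tvi'.
rewrite mxE; apply: (mulfI N0'); rewrite mulr0.
transitivity (- (\sum_i r 0 i * g i)%:~R : rat); last by rewrite gr oppr0.
rewrite rmorph_sum /= mulr_sumr -sumrN; apply: eq_bigr => i _.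
rewrite intrM -gE mxE; case: ifP => _; last by rewrite mul0r !mulr0 oppr0.
by rewrite mulrCA mulNr.
Qed.

(** A rational solution [D] has [rho_i(D) = -r_i] on the support, so [l = -N D] pairs to [N r_i],
    and [l] at an [N]-th root of [s] acts on [v] as [s] does. *)
Lemma solvable_cstar_orbit v (s : R[i]) : s != 0 ->
  (offset_row (supp v) <= weight_mx (supp v))%MS ->
  torus_orbit rho v (cstar_act r s v).
Proof.
move=> s0 /submxP[D DE].
have [N N0 [l lE]] := common_denominator (fun j => - D 0 j).
pose q := N.-root s.
have q0 : q != 0 by rewrite rootC_eq0.
exists (one_psg l q); first exact: torus_one_psg.
apply/rowP => i; rewrite !mxE torus_char_one_psg //.
have [->|vi0] := eqVneq ((v : 'rV_n) 0 i) 0; first by rewrite !mulr0.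
congr (_ * _); rewrite -[in RHS](rootCK N0 s) -/q exprnP exprz_exp.
congr (q ^ _).
apply: (@intr_inj rat); rewrite rmorph_sum /= intrM.
have iv : i \in supp v by rewrite inE.
have /rowP/(_ i) := DE; rewrite !mxE iv => /eqP.
rewrite eqr_oppLR -sumrN => /eqP->.
rewrite mulr_sumr; apply: eq_bigr => j _.
by rewrite !mxE iv intrM -lE; ring.
Qed.

End WeightSystem.

(** * Points of the quotient are orbits *)

Section RegularQuotient.
Variables (R : realType) (k n : nat) (rho : 'M[int]_(n, k)) (xi : 'rV[int]_k).
Hypothesis xi_reg : regular_linearization R rho xi.
Implicit Types (v w : affine_space R n) (x : git_quotient R rho xi).

Lemma open_principal_open (p : mpoly n R[i]) : open (principal_open p).
Proof. by move=> v pv; exists p. Qed.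

(** A semistable [u] is stable, so some invariant principal open set contains it and has relatively
    closed orbits. An orbit with [u] in its closure meets this set, hence contains [u]; orbits whose
    closures share [u] coincide. *)
Lemma git_classE v : semistable rho xi v ->
  git_class rho xi v = torus_orbit rho v.
Proof.
move=> vss.
have closed_orbit w u : semistable rho xi u -> closure (torus_orbit rho w) u ->
    torus_orbit rho w u.
  move=> uss wu; have [_ [m [p [m0 pinv pu pcl]]]] := xi_reg uss.
  apply: pcl => //; have [|w' [ww' pw']] := wu (principal_open p).
    by apply: open_nbhs_nbhs; split => //; exact: open_principal_open.
  exact/(principal_open_orbit pinv ww').
apply/seteqP; split=> w.
  move=> [wss [u [[vu wu] uss]]].
  rewrite -(torus_orbit_eq (closed_orbit _ _ uss vu)).
  rewrite (torus_orbit_eq (closed_orbit _ _ uss wu)); exact: torus_orbit_refl.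
move=> vw; split; first exact: semistable_orbit vss vw.
exists v; split=> //; split; apply: subset_closure.
  exact: torus_orbit_refl.
by rewrite (torus_orbit_eq vw); exact: torus_orbit_refl.
Qed.

Lemma git_projP x : exists v (vss : semistable rho xi v), x = git_proj vss.
Proof.
case: x => A AP; have [v vss AE] := AP; exists v, vss.
by rewrite /git_proj; move: AP; rewrite AE => AP; congr GitPoint.
Qed.

Lemma git_proj_eq v w (vss : semistable rho xi v) (wss : semistable rho xi w) :
  git_proj vss = git_proj wss <-> torus_orbit rho v w.
Proof.
split=> [/(congr1 (@git_point _ _ _ _ _))|vw] /=.
  by rewrite !git_classE // => ->; exact: torus_orbit_refl.
have vwE : git_class rho xi v = git_class rho xi w.
  by rewrite !git_classE // (torus_orbit_eq vw).
rewrite /git_proj; move: (ex_intro2 _ _ v _ _) (ex_intro2 _ _ w _ _).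
by rewrite vwE => a b; congr GitPoint.
Qed.

Lemma git_coord_locusP i v (vss : semistable rho xi v) :
  git_coord_locus rho xi i (git_proj vss) <-> (v : 'rV_n) 0 i = 0.
Proof.
split=> [[w [wss [wi0 /git_proj_eq vw]]]|vi0]; last by exists v, vss.
by apply/eqP; rewrite -(torus_orbit_coord i vw) wi0.
Qed.

Lemma git_openP (A : set (git_quotient R rho xi)) :
  open A <-> forall v (vss : semistable rho xi v), A (git_proj vss) ->
    exists2 p, principal_open p v &
      forall w, principal_open p w ->
        exists wss : semistable rho xi w, A (git_proj wss).
Proof.
split=> [oA v vss Av|oA]; first by apply: (oA v); exists vss.
by move=> v [vss Av]; exact: oA Av.
Qed.

Lemma closed_git_coord_locus i : closed (git_coord_locus (R := R) rho xi i).
Proof.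
rewrite -openC; apply/git_openP => v vss vi.
have /eqP vi0 := contra_not (git_coord_locusP i vss).2 vi.
have [m [p [m0 pinv pv]]] := vss.
(* The factor [p] keeps nearby points semistable, the other keeps coordinate [i] nonzero. *)
exists (p * mcoord R i).
  by rewrite /principal_open /= pevalM peval_coord mulf_neq0.
move=> w; rewrite /principal_open /= pevalM peval_coord mulf_eq0.
move=> /norP[pw wi0].
have wss : semistable rho xi w by exists m, p.
by exists wss => /git_coord_locusP /eqP; apply/negP.
Qed.

(** Regularity makes the stabilizer finite, so the weights in the support span. *)
Lemma weights_ker0 v (u : 'rV[R[i]]_k) : semistable rho xi v ->
  u *m map_mx ratr (weight_mx rho (supp v)) = 0 -> u = 0.
Proof.
move=> /xi_reg[/finite_stabilizer_row_free vfree _] uv.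
have ufree : row_free (map_mx (@ratr R[i]) (weight_mx rho (supp v))).
  by rewrite row_free_map.
by apply: (row_free_inj ufree); rewrite uv mul0mx.
Qed.

(** * Stable isolated intersections and their loci *)

Variable r : 'rV[int]_n.
Implicit Types (P Q : 'rV[R[i]]_k).

(** Two solutions of the system for [supp v] differ by a kernel vector. This makes the loci of
    distinct points disjoint. *)
Lemma index_set_uniq v P Q : semistable rho xi v ->
  supp v `<=` index_set rho r P -> supp v `<=` index_set rho r Q -> P = Q.
Proof.
move=> vss /flin_system vP /flin_system vQ; apply/eqP; rewrite -subr_eq0.
by apply/eqP/(weights_ker0 vss); rewrite mulmxBl vP vQ subrr.
Qed.

Lemma semistable_isolated v P : semistable rho xi v ->
  supp v `<=` index_set rho r P -> stable_isolated_intersections rho xi r P.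
Proof.
move=> vss vP; split; last exact/(in_weight_coneS vP)/semistableP.
exists (index_set rho r P); apply/seteqP; split=> [Q PQ|_ ->]; last by move=> i.
by apply: (index_set_uniq vss _ vP) => i /vP /PQ.
Qed.

Lemma git_locusP v (vss : semistable rho xi v) P :
  git_locus rho xi r P (git_proj vss) <-> supp v `<=` index_set rho r P.
Proof.
split=> [vP i|vP i iP].
  by apply: contraPP => /vP /git_coord_locusP vi0; rewrite /supp /= vi0 eqxx.
apply/git_coord_locusP/eqP; apply: contrapT => vi0; apply: iP; apply: vP.
exact/negP.
Qed.

(** The 0/1 indicator vector of [I_P] is semistable by the cone criterion. It acts as a generic
    point of the locus, from which [I_P] can be recovered. *)
Lemma stable_isolated_generic P : stable_isolated_intersections rho xi r P ->
  exists v, semistable rho xi v /\ supp v = index_set rho r P.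
Proof.
move=> [_ Pxi].
exists (\row_i (if i \in index_set rho r P then 1 else 0)).
set v := \row_i _.
have vP : supp v = index_set rho r P.
  apply/seteqP; split=> i; rewrite /supp /= mxE; last first.
    by move=> /mem_set->; exact: oner_neq0.
  by case: ifPn; rewrite ?eqxx // inE.
by split=> //; apply/semistableP; rewrite vP.
Qed.

(** * The fixed locus and its connected components *)

Lemma cstar_torus_act s t v :
  cstar_act r s (torus_act rho t v) = torus_act rho t (cstar_act r s v).
Proof. by apply/rowP => i; rewrite !mxE mulrCA. Qed.

Lemma fixed_locusP v (vss : semistable rho xi v) :
  fixed_locus rho xi r (git_proj vss) <->
  exists P, supp v `<=` index_set rho r P.
Proof.
rewrite flin_solvable /fixed_locus /= git_classE //; split=> [vfix|sol s s0].
  (* Invariance under [s = 2] alone already gives solvability. *)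
  apply: cstar_orbit_solvable; rewrite -(vfix 2%:R) ?pnatr_eq0 //.
  by exists v => //; exact: torus_orbit_refl.
rewrite -[RHS](torus_orbit_eq (solvable_cstar_orbit s0 sol)).
apply/seteqP; split=> [_ [_ [t tt <-] <-]|_ [t tt <-]].
  by rewrite cstar_torus_act; exists t.
by exists (torus_act rho t v); [exists t | rewrite cstar_torus_act].
Qed.

Lemma git_locus_fixed P : git_locus rho xi r P `<=` fixed_locus rho xi r.
Proof.
move=> x; have [v [vss ->]] := git_projP x => /git_locusP vP.
by apply/fixed_locusP; exists P.
Qed.

Lemma closed_git_locus P : closed (git_locus rho xi r P).
Proof. by apply: closed_bigI => i _; exact: closed_git_coord_locus. Qed.

(* Two points of the linear space V_P are joined by a line, on which a nonempty
   Zariski open set is cofinite. *)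
Lemma git_locus_irreducible P (A B : set (git_quotient R rho xi)) :
  open A -> open B ->
  git_locus rho xi r P `&` A !=set0 -> git_locus rho xi r P `&` B !=set0 ->
  git_locus rho xi r P `&` A `&` B !=set0.
Proof.
move=> oA oB [x [+ +]] [y [+ +]].
have [v [vss ->]] := git_projP x; have [w [wss ->]] := git_projP y.
move=> /git_locusP vP Av /git_locusP wP Bw.
have [p pv pA] := (git_openP A).1 oA v vss Av.
have [q qw qB] := (git_openP B).1 oB w wss Bw.
pose l i : {poly R[i]} := ((v : 'rV_n) 0 i)%:P +
  'X * ((w : 'rV_n) 0 i - (v : 'rV_n) 0 i)%:P.
pose u s : affine_space R n := \row_i (l i).[s].
have uE s i : (u s : 'rV_n) 0 i =
    (v : 'rV_n) 0 i + s * ((w : 'rV_n) 0 i - (v : 'rV_n) 0 i).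
  by rewrite mxE !hornerE.
have [p' p'E] := peval_poly_curve p l; have [q' q'E] := peval_poly_curve q l.
have p'0 : p' != 0.
  apply: contraNneq pv => p'0; rewrite -(horner0 0) -p'0 -p'E; apply/eqP.
  by congr (peval p _); apply/rowP => i; rewrite -/(u 0) uE mul0r addr0.
have q'0 : q' != 0.
  apply: contraNneq qw => q'0; rewrite -(horner0 1) -q'0 -q'E; apply/eqP.
  by congr (peval q _); apply/rowP => i; rewrite -/(u 1) uE mul1r subrKC.
have [m] := poly_nonroot (mulf_neq0 p'0 q'0).
rewrite hornerM mulf_eq0 => /norP[]; rewrite -p'E -q'E.
move=> /pA[uss Au] /qB[uss' Bu]; exists (git_proj uss).
split; last by rewrite (Prop_irrelevance uss uss').
split=> //; apply/git_locusP => i; apply: contraPP => iP.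
rewrite /supp /= -/(u _) uE.
have /eqP-> : (v : 'rV_n) 0 i == 0 by apply: contrapT => /negP/vP.
have /eqP-> : (w : 'rV_n) 0 i == 0 by apply: contrapT => /negP/wP.
by rewrite subr0 mulr0 addr0 eqxx.
Qed.

(** For a proper nonempty relatively clopen part, cut out by an open [C] and a closed [D],
    irreducibility would give a point of the locus in [C] but not in [D]. *)
Lemma connected_git_locus P : connected (git_locus rho xi r P).
Proof.
move=> B B0 [C oC BC] [D cD BD]; apply: contrapT => BP.
have [|||z [[zP zC]]] := @git_locus_irreducible P C (~` D) oC.
- by rewrite openC.
- by rewrite -BC.
- apply: contrapT => PD; apply: BP; rewrite BD.
  apply/seteqP; split=> [z []|z zP] //.
  by split=> //; apply: contrapT => zD; apply: PD; exists z.
by apply; have : B z; [rewrite BC | rewrite BD => -[]].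
Qed.

(** The locus is connected and closed, and in the component its complement is cut out by the closed
    union of the other loci; being relatively clopen, it fills the component. *)
Lemma fixed_component v (vss : semistable rho xi v) P :
  supp v `<=` index_set rho r P ->
  connected_component (fixed_locus rho xi r) (git_proj vss) =
  git_locus rho xi r P.
Proof.
move=> vP; have Pv : git_locus rho xi r P (git_proj vss) by exact/git_locusP.
apply/seteqP; split; last first.
  apply: connected_component_max => //; first exact: git_locus_fixed.
  exact: connected_git_locus.
set C := connected_component _ _.
have Cv : C (git_proj vss).
  by apply: connected_component_refl; exact: git_locus_fixed Pv.
(* Indexing by subsets [J] rather than by points [Q], which may be infinitely many, makes the union
   finite and so closed. *)
pose others := [set J : {set 'I_n} | exists2 Q, Q != P &
  [set` J] = index_set (R := R) rho r Q].
pose D := \bigcup_(J in others) \bigcap_(j in ~` [set` J])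
  git_coord_locus (R := R) rho xi j.
have cD : closed D.
  apply: closed_bigcup; first exact: finite_finset.
  by move=> J _; apply: closed_bigI => i _; exact: closed_git_coord_locus.
have DE x : D x <-> exists2 Q, Q != P & git_locus rho xi r Q x.
  split=> [[J [Q QP JQ]]|[Q QP Qx]]; first by rewrite JQ => Qx; exists Q.
  have QE : [set` finset (mem (index_set rho r Q))] = index_set rho r Q.
    by apply/seteqP; split=> i /=; rewrite inE ?in_setE.
  by exists (finset (mem (index_set rho r Q))); [exists Q | rewrite QE].
have CP : C `&` git_locus rho xi r P = C `&` ~` D.
  apply/seteqP; split=> x [Cx]; have [w [wss xE]] := git_projP x.
    rewrite xE => /git_locusP wP; split; first by rewrite -xE.
    move=> /DE[Q /eqP QP /git_locusP wQ]; apply: QP.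
    exact: index_set_uniq wss wQ wP.
  move=> Dx; split=> //; have := connected_component_sub Cx; rewrite xE.
  move=> /fixed_locusP[Q wQ]; have [<-|QP] := eqVneq Q P.
    exact/git_locusP.
  by case: Dx; apply/DE; exists Q => //; rewrite xE; exact/git_locusP.
suff <- : C `&` git_locus rho xi r P = C by move=> x [].
apply: (@component_connected _ (fixed_locus rho xi r) (git_proj vss)).
- by exists (git_proj vss).
- by exists (~` D) => //; rewrite openC.
- by exists (git_locus rho xi r P) => //; exact: closed_git_locus.
Qed.

Lemma fixed_componentP (F : set (git_quotient R rho xi)) :
  fixed_components rho xi r F <->
  exists2 P, stable_isolated_intersections rho xi r P &
    git_locus (R := R) rho xi r P = F.
Proof.
split=> [[x + <-]|[P Pst <-]].
  have [v [vss ->]] := git_projP x => /fixed_locusP[P vP].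
  exists P; first exact: semistable_isolated vss vP.
  by rewrite (fixed_component vss vP).
have [v [vss vP]] := stable_isolated_generic Pst.
exists (git_proj vss); first by apply/fixed_locusP; exists P; rewrite vP.
by apply: fixed_component; rewrite vP.
Qed.

(** * Injectivity and the inverse map *)

(** A generic point of the first locus lies in the second, so both [P] and [Q] solve its system. *)
Lemma git_locus_inj P Q : stable_isolated_intersections rho xi r P ->
  git_locus (R := R) rho xi r P = git_locus rho xi r Q -> P = Q.
Proof.
move=> /stable_isolated_generic[v [vss vP]] PQ.
apply: (index_set_uniq vss); first by rewrite vP.
by apply/(git_locusP vss); rewrite -PQ; apply/git_locusP; rewrite vP.
Qed.

(** At a generic point every coordinate in [I_P] is nonzero, so no such coordinate vanishes on the
    whole locus. *)
Lemma component_index_set_git_locus P :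
  stable_isolated_intersections rho xi r P ->
  component_index_set (git_locus (R := R) rho xi r P) = index_set rho r P.
Proof.
move=> /stable_isolated_generic[v [vss vP]]; apply/seteqP; split=> i.
  by move=> Pi; apply: contrapT => iP; apply: Pi => x; apply.
rewrite -[X in X i -> _]vP => vi0 Pi; have := Pi (git_proj vss).
move=> /(_ _)/git_coord_locusP vi; move: vi0; rewrite /supp /= vi ?eqxx //.
by apply/git_locusP; rewrite vP.
Qed.

(** Any [I] cutting out [P] is contained in [I_P], so the larger intersection is no bigger and still
    contains [P]. *)
Lemma bigcap_index_set P : isolated_intersections rho r P ->
  \bigcap_(i in index_set rho r P) flin_zero rho r i = [set P].
Proof.
move=> [I IP]; apply/seteqP; split=> [Q PQ|_ -> i] //.
rewrite -IP => i Ii; apply: PQ.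
by have : [set P] P by []; rewrite -IP; apply.
Qed.

End RegularQuotient.

Theorem proposition3p1 (R : realType) (k n : nat) (rho : 'M[int]_(n, k))
    (xi : 'rV[int]_k) (r : 'rV[int]_n)
    (heff : effective_action R rho)
    (hreg : regular_linearization R rho xi) :
  set_bij (stable_isolated_intersections rho xi r)
          (fixed_components rho xi r)
          (git_locus (R := R) rho xi r) /\
  forall F : set (git_quotient R rho xi), fixed_components rho xi r F ->
    exists P, [/\ stable_isolated_intersections rho xi r P,
      git_locus rho xi r P = F &
      \bigcap_(i in component_index_set F) flin_zero rho r i = [set P]].
Proof.
split; first split.
- by move=> P Pst; apply/(fixed_componentP hreg); exists P.
- by move=> P Q; rewrite !inE => Pst _; exact: git_locus_inj.
- by move=> F /(fixed_componentP hreg)[P Pst PF]; exists P.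
move=> F /(fixed_componentP hreg)[P Pst <-]; exists P; split=> //.
by rewrite component_index_set_git_locus // bigcap_index_set //; case: Pst.
Qed.
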